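(* Let $a\in l^2(\mathbb{Z}^2)$ be a sequence with $(L_{\mathcal{M}}a)(\xi)\in L^\infty(\mathbb{R}^2)$. For $j,k\in\{0,1,\dots,m-1\}$ put $e_j^k=e_j^k(\xi)=\big(\overline{\eta}_{\mathcal{M}}[BM^{-1}(\xi+\gamma_k)]\big)^{j+1}$, and let $\mathcal{A}_{\mathcal{M}}(\xi)$ be the $m\times m$ matrix whose entry in row $j$ and column $k$ ($0\le j,k\le m-1$) is $$e_j^k\,\big((L_{\mathcal{M}}a)[BM^{-1}(\xi+\gamma_k)]\big)^{j},$$ so that the row $j=0$ is $(e_0^0,e_0^1,\dots,e_0^{m-1})$. Then any $c\in l^2(\mathbb{Z}^2)$ can be recovered in a stable way, i.e., the inverse of $\mathcal{A}_{\mathcal{M}}(\xi)$ is bounded, from the dynamical sampling measurements $$y_0(k)=c(M^Tk),\qquad y_j(k)=(a^j\star_d c)(M^Tk),\quad j=1,2,\dots,m-1,\ k\in\mathbb{Z}^2,$$ if and only if there exists $\alpha>0$ such that the set $\{\xi\in\mathbb{R}^2 : |\det(\mathcal{A}_{\mathcal{M}}(\xi))|<\alpha\}$ has (Lebesgue) measure zero.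
   Context: Let $A,B,C,D\in\mathbb{R}^{2\times2}$ with $B$ non-singular and $\mathcal{M}=[A,B;C,D]$ real symplectic, i.e. $AB^T=BA^T$, $CD^T=DC^T$, $AD^T-BC^T=I$. Let $\lambda_{\mathcal{M}}(t)=e^{i\pi t^TB^{-1}At}$ and $\eta_{\mathcal{M}}(\xi)=e^{i\pi\xi^TDB^{-1}\xi}$ for $t,\xi\in\mathbb{R}^2$; a bar denotes complex conjugation. $\sqrt{\det(iB)}$ is a fixed square root of $\det(iB)$. For $s\in l^2(\mathbb{Z}^2)$, the two-dimensional discrete time non-separable linear canonical transform (2D-DT-NS-LCT) is $$(L_{\mathcal{M}}s)(\xi)=\frac{1}{\sqrt{\det(iB)}}\sum_{k\in\mathbb{Z}^2}s(k)e^{i\pi k^TB^{-1}Ak-2i\pi k^TB^{-1}\xi+i\pi\xi^TDB^{-1}\xi},\qquad \xi\in\mathbb{R}^2.$$ For sequences $s,c$ on $\mathbb{Z}^2$ the canonical convolution is $$(s\star_d c)(l)=\frac{\overline{\lambda}_{\mathcal{M}}(l)}{\sqrt{\det(iB)}}\sum_{k\in\mathbb{Z}^2}\lambda_{\mathcal{M}}(k)s(k)\lambda_{\mathcal{M}}(l-k)c(l-k),\quad l\in\mathbb{Z}^2,$$ and $a^j=a\star_d\cdots\star_d a$ ($j$ factors). $M$ is a fixed $2\times2$ non-singular integer matrix, $m=|\det(M)|$, and $\gamma_0=[0,0]^T,\gamma_1,\dots,\gamma_{m-1}$ are the $m$ distinct elements of $\mathcal{N}(M)=\{k\in\mathbb{Z}^2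 : k=Mx,\ x\in[0,1)^2\}$. Stable recovery is, by definition, the condition that the inverse of $\mathcal{A}_{\mathcal{M}}(\xi)$ is bounded: $\mathcal{A}_{\mathcal{M}}(\xi)$ is invertible for almost every $\xi$ and $\xi\mapsto\mathcal{A}_{\mathcal{M}}(\xi)^{-1}$ is essentially bounded. *)

(* Defs.v *)
From HB Require Import structures.
From mathcomp Require Import all_boot all_order all_algebra.
From mathcomp Require Import complex.
From mathcomp Require Import all_classical all_reals all_analysis.

Set Implicit Arguments.
Unset Strict Implicit.
Unset Printing Implicit Defensive.

Import Order.TTheory GRing.Theory Num.Theory.
Import numFieldNormedType.Exports.
Local Open Scope classical_set_scope.
Local Open Scope ring_scope.
Local Open Scope complex_scope.

Definition col2 (T : Type) (x : T * T) : 'cV[T]_2 :=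
  \col_(i < 2) if i == 0 then x.1 else x.2.

Definition intc (R : nzRingType) m n (k : 'M[int]_(m, n)) : 'M[R]_(m, n) :=
  map_mx intr k.

Definition bilin (R : nzRingType) (Q : 'M[R]_2) (x y : 'cV[R]_2) : R :=
  (x^T *m Q *m y) 0 0.

Section Defs.
Context {R : realType}.
Implicit Types (A B C D : 'M[R]_2) (M : 'M[int]_2).
Implicit Types (s c a : 'cV[int]_2 -> R[i]).
Implicit Types (t xi : 'cV[R]_2).

(* Lebesgue measure of the plane; points x : R * R are read as the column
   vectors col2 x. *)
Definition leb2 := (@lebesgue_measure R \x @lebesgue_measure R)%E.

Definition cnorm (z : R[i]) : R := Normc.normc z.

(* exp(i theta) *)
Definition expi (theta : R) : R[i] := cos theta +i* sin theta.

Definition symplectic A B C D : Prop :=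
  [/\ A *m B^T = B *m A^T, C *m D^T = D *m C^T
    & A *m D^T - B *m C^T = 1%:M].

Definition lambdaM A B t : R[i] := expi (pi * bilin (invmx B *m A) t t).

Definition etaM B D xi : R[i] := expi (pi * bilin (D *m invmx B) xi xi).

Definition l2_seq s : Prop :=
  esum.summable [set: 'cV[int]_2] (fun k => (cnorm (s k) ^+ 2)%:E).

(* Sum of f over the k with both coordinates in [-N, N]. Series indexed by Z^2
   are limits of these partial sums. *)
Definition square_sum (V : nmodType) (f : 'cV[int]_2 -> V) (N : nat) : V :=
  \sum_(i < N.*2.+1) \sum_(j < N.*2.+1)
    f (col2 (i%:Z - N%:Z, j%:Z - N%:Z)).

(* The parameter q is the chosen square root of det (i B). *)
Definition lct_partial A B D (q : R[i]) s (N : nat) xi : R[i] :=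
  q^-1 * square_sum (fun k =>
    s k * expi (pi * bilin (invmx B *m A) (intc R k) (intc R k)
                - 2 * pi * bilin (invmx B) (intc R k) xi
                + pi * bilin (D *m invmx B) xi xi)) N.

Definition cmeasurable (f : R * R -> R[i]) : Prop :=
  measurable_fun setT (fun x => complex.Re (f x)) /\
  measurable_fun setT (fun x => complex.Im (f x)).

(* For s in l^2 the series defining L_M s need not converge pointwise: L_M s is
   the almost-everywhere class of the limit of its partial sums in L^2 on every
   bounded set. The predicate says that F is a representative of that class. *)
Definition is_LCT A B D (q : R[i]) s (F : 'cV[R]_2 -> R[i]) : Prop :=
  cmeasurable (F \o @col2 R) /\
  forall r : R,
    (\int[leb2]_(x in `[(- r)%R, r] `*` `[(- r)%R, r])
        (cnorm (F (col2 x) - lct_partial A B D q s N (col2 x)) ^+ 2)%R%:E)%E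
      @[N --> \oo] --> 0%E.

(* Membership in L^oo of the plane of a function f (measurability apart). *)
Definition ess_bounded (f : R * R -> R[i]) : Prop :=
  (Lnorm leb2 +oo (fun x => (cnorm (f x))%:E) < +oo)%E.

Definition series2 (f : 'cV[int]_2 -> R[i]) : R[i] :=
  lim (square_sum (fun k => complex.Re (f k)) @ \oo)
  +i* lim (square_sum (fun k => complex.Im (f k)) @ \oo).

Definition dconv A B (q : R[i]) s c (l : 'cV[int]_2) : R[i] :=
  (lambdaM A B (intc R l))^* / q *
  series2 (fun k => lambdaM A B (intc R k) * s k *
                    lambdaM A B (intc R (l - k)) * c (l - k)).

(* dpow A B q a j is a^(j+1) = a * ... * a (j+1 factors). *)
Definition dpow A B (q : R[i]) a (j : nat) : 'cV[int]_2 -> R[i] :=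
  iter j (fun b => dconv A B q b a) a.

Definition measurement A B (q : R[i]) M a c (j : nat) (k : 'cV[int]_2) : R[i] :=
  if j is j'.+1 then dconv A B q (dpow A B q a j') c (M^T *m k)
  else c (M^T *m k).

(* N(M), the integer points of M [0,1)^2. *)
Definition fundamental_points M : set 'cV[int]_2 :=
  [set k | exists2 x : 'cV[R]_2, (forall i, 0 <= x i 0 < 1) &
                                 intc R k = intc R M *m x].

(* The matrix of the linear system relating the Fourier series of the
   measurements to the values of L_M c at the points B M^-1 (xi + gamma_k).
   F is (a representative of) L_M a. *)
Definition sampling_mx B D M (gamma : 'I_`|\det M|%N -> 'cV[int]_2)
    (F : 'cV[R]_2 -> R[i]) xi : 'M[R[i]]_(`|\det M|%N) :=
  \matrix_(j, k)
    let p := B *m invmx (intc R M) *m (xi + intc R (gamma k)) in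
    (etaM B D p)^* ^+ j.+1 * F p ^+ j.

(* Stable recovery from the samples  measurement A B q M a c j, j < |det M|,
   of an arbitrary c in l^2 is by definition the property below of
   S = sampling_mx B D gamma (L_M a). *)
Definition stable_recovery (m : nat) (S : 'cV[R]_2 -> 'M[R[i]]_m) : Prop :=
  {ae leb2, forall x, S (col2 x) \in unitmx} /\
  forall i j, ess_bounded (fun x => invmx (S (col2 x)) i j).

End Defs.

(* Main.v *)
(* The entries of the sampling matrix are essentially bounded: |eta| = 1, and
   the essential bound on L_M a survives composition with the invertible affine
   map xi |-> B M^-1 (xi + gamma_k), because such a map is a product of shears
   and coordinate swaps, and Fubini reduces a shear to an affine map of the
   line, so that preimages of null sets are null. For a matrix S with
   essentially bounded entries, S^-1 = adj S / det S is bounded as soon as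
   |det S| is bounded below; conversely a bound on S^-1 bounds
   1 / |det S| = |det S^-1|. *)

Require Import Defs.
From mathcomp Require Import all_boot all_order all_algebra.
From mathcomp Require Import perm complex.
From mathcomp Require Import all_classical all_reals all_analysis.
From mathcomp Require Import ess_sup_inf measurable_realfun ring.
Import Order.TTheory GRing.Theory Num.Theory.
Import numFieldNormedType.Exports.
Local Open Scope classical_set_scope.
Local Open Scope ring_scope.
Local Open Scope complex_scope.

(** * Determinant and adjugate bounds from a bound on the entries *)

Lemma normr_det_le (F : numDomainType) n (A : 'M[F]_n) K :
  (forall i j, `|A i j| <= K) -> `|\det A| <= n`!%:R * K ^+ n.
Proof.
move=> AK; rewrite /determinant; apply: le_trans (ler_norm_sum _ _ _) _.
have <- : \sum_(s : 'S_n) K ^+ n = n`!%:R * K ^+ n.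
  by rewrite sumr_const card_Sn mulr_natl.
apply: ler_sum => s _; rewrite normrM normr_sign mul1r normr_prod.
have -> : K ^+ n = \prod_(i < n) K by rewrite prodr_const card_ord.
by apply: ler_prod => i _; rewrite normr_ge0 AK.
Qed.

Lemma normr_adj_le (F : numDomainType) n (A : 'M[F]_n) K :
  (forall i j, `|A i j| <= K) ->
  forall i j, `|\adj A i j| <= n.-1`!%:R * K ^+ n.-1.
Proof.
move=> AK i j; rewrite mxE normrM normr_sign mul1r.
by apply: normr_det_le => *; rewrite !mxE.
Qed.

(** The norm on [R[i]] takes values in [R[i]]; this conversion transports bounds between it and the
    real-valued [cnorm]. *)
Lemma normc_cnorm (R : realType) (z : R[i]) : `|z| = (cnorm z)%:C.
Proof. by []. Qed.

Lemma cnorm_det_le (R : realType) n (A : 'M[R[i]]_n) K :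
  (forall i j, cnorm (A i j) <= K) -> cnorm (\det A) <= n`!%:R * K ^+ n.
Proof.
move=> AK; rewrite -lecR -normc_cnorm rmorphM rmorph_nat rmorphXn /=.
by apply: normr_det_le => i j; rewrite normc_cnorm lecR.
Qed.

Lemma cnorm_adj_le (R : realType) n (A : 'M[R[i]]_n) K :
  (forall i j, cnorm (A i j) <= K) ->
  forall i j, cnorm (\adj A i j) <= n.-1`!%:R * K ^+ n.-1.
Proof.
move=> AK i j; rewrite -lecR -normc_cnorm rmorphM rmorph_nat rmorphXn /=.
by apply: normr_adj_le => k l; rewrite normc_cnorm lecR.
Qed.

Lemma cnorm_expi (R : realType) (t : R) : cnorm (expi t) = 1.
Proof. by rewrite /cnorm /expi /Normc.normc cos2Dsin2 sqrtr1. Qed.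

Lemma cnorm_ge0 (R : realType) (z : R[i]) : 0 <= cnorm z.
Proof. by rewrite -lecR -normc_cnorm normr_ge0. Qed.

(** * Essential boundedness as an almost-everywhere bound *)

Lemma leb2_setT (R : realType) : (@leb2 R setT = +oo)%E.
Proof.
have muT : lebesgue_measure [set: measurableTypeR R] = +oo%E.
  by rewrite -set_itvNyy; exact: lebesgue_measure_itv.
transitivity (@lebesgue_measure R setT * @lebesgue_measure R setT)%E.
  by rewrite /leb2 -setXTT; exact: product_measure1E.
by rewrite muT mulyy.
Qed.

Lemma ess_boundedP (R : realType) (f : R * R -> R[i]) :
  ess_bounded f <-> exists K, {ae leb2, forall x, cnorm (f x) <= K}.
Proof.
have absE : abse \o (fun x => (cnorm (f x))%:E) = fun x => (cnorm (f x))%:E.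
  by apply/funext => x /=; rewrite ger0_norm ?cnorm_ge0.
(* At exponent [+oo], [Lnorm] is the essential supremum only if the whole space has positive
   measure. *)
have T0 : (0 < @leb2 R setT)%E by rewrite leb2_setT.
rewrite /ess_bounded unlock; case: ifPn => [_|/negP[]]; last exact: T0.
rewrite absE; split=> [|[K fK]].
  (* The value [+oo] contradicts the hypothesis; the value [-oo] gives an absurd bound almost
     everywhere, so any constant serves. *)
  case E : (ess_sup _ _) => [r| |] //= _; [exists r|exists 0];
    by apply: filterS (ess_sup_ge leb2 (fun x => (cnorm (f x))%:E)) => x;
      rewrite E.
by apply: (@le_lt_trans _ _ K%:E); [exact/ess_supP|exact: ltry].
Qed.

(** * Null sets of the plane under invertible affine maps *)

(** The right-hand side is a scaled pushforward measure that agrees with Lebesgue measure on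
    half-open intervals, hence everywhere by uniqueness. *)
Lemma lebesgue_preimage_affine (R : realType) (t c : R) (N : set R) :
  t != 0 -> measurable N -> lebesgue_measure N =
    (`|t|%:E * lebesgue_measure ((fun y => (t * y + c)%R) @^-1` N))%E.
Proof.
move=> t0 mN.
pose f : measurableTypeR R -> measurableTypeR R := fun y => t * y + c.
have mf : measurable_fun [set: measurableTypeR R] f.
  by apply: measurable_funD => //; apply: measurable_funM.
pose k : {nonneg R} := NngNum (normr_ge0 t).
have scaleE X : ocitv X ->
    lebesgue_measure X = (`|t|%:E * lebesgue_measure (f @^-1` X))%E.
  move=> [[a b] _ <-]; rewrite /=.
  have [tp|tn] : 0 < t \/ t < 0.
    by move: t0; rewrite neq_lt => /orP[]; [right|left].
    have -> : f @^-1` `]a, b] = `](a - c) / t, (b - c) / t]%classic.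
      apply/seteqP; split=> y /=;
        rewrite !in_itv/= /f ltr_pdivrMr// ler_pdivlMr//;
        by rewrite ltrBlDr lerBrDr mulrC.
    rewrite !lebesgue_measure_itv /= !lte_fin ltr_pM2r ?invr_gt0// ltrD2r.
    case: ifP => ab; last by rewrite mule0.
    by rewrite -!EFinD -EFinM gtr0_norm//; congr EFin; field.
  have -> : f @^-1` `]a, b] = `[(b - c) / t, (a - c) / t[%classic.
    apply/seteqP; split=> y /=;
      rewrite !in_itv/= /f ltr_ndivlMr// ler_ndivrMr//;
      by rewrite ltrBlDr lerBrDr mulrC andbC.
  rewrite !lebesgue_measure_itv /= !lte_fin ltr_nM2r ?invr_lt0// ltrD2r.
  case: ifP => ab; last by rewrite mule0.
  by rewrite -!EFinD -EFinM ltr0_norm//; congr EFin; field.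
exact: (@lebesgue_measure_unique R (mscale k (pushforward lebesgue_measure f))).
Qed.

(** Both orders of integration give measures with the same values on rectangles. The order built
    into [leb2] uses [xsection]; this one serves the coordinate swap. *)
Lemma leb2_ysection (R : realType)
    (N : set (measurableTypeR R * measurableTypeR R)) :
  measurable N ->
  leb2 N = (\int[lebesgue_measure]_y lebesgue_measure (ysection N y))%E.
Proof.
move=> mN; apply: (@product_measure_unique _ _ _ _ _ _ _
  (@lebesgue_measure R \x^ @lebesgue_measure R)%E) => // X Y mX mY.
exact: product_measure2E.
Qed.

Lemma ae_preimage d d' (T : measurableType d) (U : measurableType d')
    (R : realType) (mu : {measure set T -> \bar R})
    (nu : {measure set U -> \bar R}) (f : T -> U) :
  measurable_fun setT f ->
  (forall N, measurable N -> nu N = 0%E -> mu (f @^-1` N) = 0%E) ->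
  forall P, {ae nu, forall y, P y} -> {ae mu, forall x, P (f x)}.
Proof.
move=> mf f0 P [N [mN N0 PN]]; exists (f @^-1` N); split.
- by rewrite -[X in measurable X]setTI; exact: mf.
- exact: f0.
- by move=> x /= Px; exact: PN.
Qed.

Lemma ae_leb2_swap (R : realType) (P : R * R -> Prop) :
  {ae leb2, forall x, P x} -> {ae leb2, forall x, P (x.2, x.1)}.
Proof.
apply: (@ae_preimage _ _ _ _ R leb2 leb2 (fun x => (x.2, x.1))).
  exact: measurable_swap.
move=> N mN N0; rewrite -N0; apply: etrans (esym (leb2_ysection _ _ mN)).
by apply: eq_integral => x _; congr lebesgue_measure.
Qed.

(** For fixed [x.1] the map is affine in [x.2] with slope [t], so all sections of a preimage are
    scaled by the same factor, the inverse of [|t|]. *)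
Lemma ae_leb2_shear (R : realType) (t s b : R) (P : R * R -> Prop) : t != 0 ->
  {ae leb2, forall x, P x} ->
  {ae leb2, forall x, P (x.1, t * x.2 + s * x.1 + b)}.
Proof.
move=> t0.
have mf : measurable_fun setT
    (fun x : measurableTypeR R * measurableTypeR R =>
       (x.1, t * x.2 + s * x.1 + b)).
  apply: measurable_fun_pair => //.
  apply: measurable_funD => //; apply: measurable_funD;
    exact: measurable_funM.
apply: (ae_preimage _ _ _ _ _ leb2 leb2 _ mf).
move=> N mN N0.
have /eqP : (`|t|%:E *
    leb2 ((fun x => (x.1, (t * x.2 + s * x.1 + b)%R)) @^-1` N) = 0)%E.
  rewrite -N0 /leb2 /product_measure1 -ge0_integralZl//; last first.
    apply: measurable_fun_xsection.
    by rewrite -[X in measurable X]setTI; exact: mf.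
  apply: eq_integral => x _ /=.
  rewrite (lebesgue_preimage_affine _ t (s * x + b) (xsection N x)) //;
    last exact: measurable_xsection.
  congr (_ * lebesgue_measure _)%E.
  by apply/seteqP; split=> y; rewrite /xsection /= !inE /= addrA.
by rewrite mule_eq0 eqe normr_eq0 (negPf t0) => /eqP.
Qed.

#[local] Instance ae_leb2_filter (R : realType) :
  Filter (nbhs (almost_everywhere (@leb2 R))).
Proof.
exact: (ae_filter_ringOfSetsType (@lebesgue_measure R \x @lebesgue_measure R)%E).
Qed.

Lemma det_mx22 (F : comPzRingType) (A : 'M[F]_2) :
  \det A = A 0 0 * A 1 1 - A 0 1 * A 1 0.
Proof.
have E1 : lift ord0 ord0 = 1 :> 'I_2 by exact/val_inj.
have E0 : lift 1 ord0 = 0 :> 'I_2 by exact/val_inj.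
rewrite (expand_det_row _ 0) !big_ord_recl big_ord0 /cofactor !det_mx11 !mxE /=.
by rewrite !E1 E0 /= expr0 expr1 mul1r mulN1r addr0 mulrN.
Qed.

Lemma ae_col2_affine (R : realType) (A : 'M[R]_2) (v : 'cV[R]_2)
    (P : 'cV[R]_2 -> Prop) :
  A \in unitmx -> {ae leb2, forall x, P (col2 x)} ->
  {ae leb2, forall x, P (A *m (col2 x + v))}.
Proof.
have LU (a b c d e f : R) (Q : R * R -> Prop) :
    d != 0 -> a * d - b * c != 0 -> {ae leb2, forall x, Q x} ->
    {ae leb2, forall x, Q (a * x.1 + b * x.2 + e, c * x.1 + d * x.2 + f)}.
  move=> d0 D0 /ae_leb2_swap.
  (* This Schur complement of the pivot [d] is the determinant divided by [d]. *)
  have a0 : a - b * c / d != 0.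
    apply: contra_neq D0 => E.
    transitivity ((a - b * c / d) * d); first by field.
    by rewrite E mul0r.
  (* The matrix factors as an upper triangular one with rows [(a - b * c / d, b / d)] and [(0, 1)]
     times a lower triangular one with rows [(1, 0)] and [(c, d)]. The swaps turn the first factor
     into a shear; the offset [e - b * f / d] compensates for the [f] added by the second. *)
  move=> /(ae_leb2_shear _ _ (b / d) (e - b * f / d) _ a0) /ae_leb2_swap.
  move=> /(ae_leb2_shear _ _ c f _ d0); apply: filterS => x /=.
  by congr (Q (_, _)); field.
rewrite unitmxE unitfE det_mx22 => D0 PH.
have E x : A *m (col2 x + v) =
    col2 (A 0 0 * x.1 + A 0 1 * x.2 + (A *m v) 0 0,
          A 1 0 * x.1 + A 1 1 * x.2 + (A *m v) 1 0).
  have E1 : lift ord0 ord0 = 1 :> 'I_2 by exact/val_inj.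
  apply/colP => i; rewrite mulmxDr [in LHS]mxE [in LHS]mxE.
  rewrite !big_ord_recl big_ord0 addr0 E1 [col2 x _ _]mxE [col2 x _ _]mxE [RHS]mxE /=.
  by case: (unliftP 0 i) => [k|] -> //=; rewrite ord1 E1.
apply: (filterS (P := fun x => P (col2 (A 0 0 * x.1 + A 0 1 * x.2 + (A *m v) 0 0,
          A 1 0 * x.1 + A 1 1 * x.2 + (A *m v) 1 0)))) => [x|].
  by rewrite E.
(* If the pivot vanishes, exchanging the columns makes [A 1 0] the pivot, nonzero because the
   determinant is. *)
have [d0|d0] := eqVneq (A 1 1) 0; last exact: (LU _ _ _ _ _ _ (P \o @col2 R)).
apply: filterS (ae_leb2_swap _ _ (LU (A 0 1) (A 0 0) (A 1 1) (A 1 0)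
  ((A *m v) 0 0) ((A *m v) 1 0) (P \o @col2 R) _ _ PH)).
- by move=> x /=; congr (P (col2 (_, _))); ring.
- by apply: contra_neq D0 => c0; rewrite d0 c0; ring.
- by apply: contra_neq D0 => E0; rewrite -[LHS]opprK -[RHS]oppr0 -E0; congr (- _); ring.
Qed.

(** * The determinant criterion for a bounded inverse *)

(** Finitely many exceptional null sets merge into one, and the sum of the [|K i|] dominates every
    bound. *)
Lemma ae_uniform_bound (R : realType) (I : finType) (f : I -> R * R -> R) :
  (forall i, exists K, {ae leb2, forall x, f i x <= K}) ->
  exists2 K, 0 <= K & {ae leb2, forall x i, f i x <= K}.
Proof.
move=> /choice[K fK]; exists (\sum_i `|K i|); first exact: sumr_ge0.
apply: filter_forall => i; apply: filterS (fK i) => x /le_trans; apply.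
by rewrite (bigD1 i)//= (le_trans (ler_norm _))// lerDl sumr_ge0.
Qed.

Lemma stable_recoveryP (R : realType) m (S : 'cV[R]_2 -> 'M[R[i]]_m) :
  (forall i j, ess_bounded (fun x => S (col2 x) i j)) ->
  stable_recovery S <->
  exists2 alpha : R, 0 < alpha &
    leb2.-negligible [set x | cnorm (\det (S (col2 x))) < alpha].
Proof.
move=> Sb; split=> [[Su Vb]|[alpha alpha0 Sa]].
  have [[i j]|K K0 VK] := @ae_uniform_bound R _ (fun ij x =>
      cnorm (invmx (S (col2 x)) ij.1 ij.2)).
    exact/ess_boundedP.
  (* [C] bounds the determinant of the inverse; [C + 1] is certainly positive, so its inverse can
     serve as [alpha]. *)
  pose C := m`!%:R * K ^+ m.
  have C0 : 0 <= C by rewrite mulr_ge0// exprn_ge0.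
  exists (C + 1)^-1; first by rewrite invr_gt0 ltr_wpDl.
  have : {ae leb2, forall x, ~ cnorm (\det (S (col2 x))) < (C + 1)^-1}.
    apply: filterS2 Su VK => x Sxu VxK.
    have /(cnorm_det_le _ _ _ _) : forall i j, cnorm (invmx (S (col2 x)) i j) <= K.
      by move=> i j; exact: (VxK (i, j)).
    rewrite -/C => dV; apply/negP; rewrite -leNgt.
    have d1 : cnorm (\det (S (col2 x))) * cnorm (\det (invmx (S (col2 x)))) = 1.
      by rewrite /cnorm -Normc.normcM -det_mulmx mulmxV// det1 Normc.normc1.
    rewrite -div1r ler_pdivrMr ?ltr_wpDl// -[leLHS]d1.
    apply: ler_wpM2l; first exact: cnorm_ge0.
    by apply: (le_trans dV); rewrite lerDl.
  by apply: negligibleS => x /=; apply: contraPnot.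
have [[i j]|K K0 SK] := @ae_uniform_bound R _ (fun ij x =>
    cnorm (S (col2 x) ij.1 ij.2)).
  exact/ess_boundedP.
have Sa' : {ae leb2, forall x, alpha <= cnorm (\det (S (col2 x)))}.
  by apply: negligibleS Sa => x /= /negP; rewrite -ltNge.
(* Besides giving invertibility, this allows unfolding [invmx], which equals the adjugate over the
   determinant only on units. *)
have unitS x : alpha <= cnorm (\det (S (col2 x))) -> S (col2 x) \in unitmx.
  rewrite unitmxE unitfE => ale; apply: contraTneq ale => ->.
  by rewrite /cnorm Normc.normc0 -ltNge.
split=> [|i j]; first exact: filterS Sa'.
(* The first factor bounds the inverse determinant, the second the minors of size [m.-1]. *)
apply/ess_boundedP; exists (alpha^-1 * (m.-1`!%:R * K ^+ m.-1)).
apply: filterS2 Sa' SK => x ax xK.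
rewrite /invmx unitS// mxE /cnorm Normc.normcM Normc.normcV.
rewrite ler_pM ?invr_ge0 ?cnorm_ge0//.
- by rewrite lef_pV2 ?posrE// (lt_le_trans alpha0).
- by apply: cnorm_adj_le => k l; exact: (xK (k, l)).
Qed.

Lemma sampling_mx_ess_bounded (R : realType) (B D : 'M[R]_2) (M : 'M[int]_2)
    (gamma : 'I_(`|\det M|%N) -> 'cV[int]_2) (F : 'cV[R]_2 -> R[i]) i j :
  B \in unitmx -> \det M != 0 -> ess_bounded (fun x => F (col2 x)) ->
  ess_bounded (fun x => sampling_mx B D gamma F (col2 x) i j).
Proof.
move=> hB hM /ess_boundedP[K FK]; apply/ess_boundedP.
have Mu : intc R M \in unitmx by rewrite unitmxE unitfE det_map_mx intr_eq0.
(* Row [i] carries the power [i] of [F], and the chirp factor has modulus 1; the absolute value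
   makes the base visibly nonnegative. *)
exists (`|K| ^+ i).
have Au : B *m invmx (intc R M) \in unitmx by rewrite unitmx_mul hB unitmx_inv.
have := ae_col2_affine _ _ (intc R (gamma j)) (fun p => cnorm (F p) <= K) Au FK.
apply: filterS => x FxK; rewrite mxE.
rewrite /cnorm Normc.normcM -/(cnorm _) -/(cnorm _).
have cnormX (z : R[i]) n : cnorm (z ^+ n) = cnorm z ^+ n.
  by apply: complexI; rewrite -normc_cnorm normrX rmorphXn.
rewrite !cnormX (_ : cnorm (_^*) = 1); last first.
  by apply: complexI; rewrite -normc_cnorm normcJ normc_cnorm cnorm_expi.
rewrite expr1n mul1r lerXn2r ?nnegrE ?cnorm_ge0//.
by rewrite (le_trans FxK)// ler_norm.
Qed.

Theorem theorem3p3 (R : realType) (A B C D : 'M[R]_2)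
    (hB : B \in unitmx) (hsymp : symplectic A B C D)
    (q : R[i]) (hq : q ^+ 2 = \det ('i%C *: map_mx (real_complex R) B))
    (M : 'M[int]_2) (hM : \det M != 0)
    (gamma : 'I_(`|\det M|%N) -> 'cV[int]_2)
    (hgamma_inj : injective gamma)
    (hgamma : range gamma = @fundamental_points R M)
    (hgamma0 : forall i : 'I_(`|\det M|%N), i = 0%N :> nat -> gamma i = 0)
    (a : 'cV[int]_2 -> R[i]) (ha : l2_seq a)
    (La : 'cV[R]_2 -> R[i]) (hLa : is_LCT A B D q a La)
    (hLa_bnd : ess_bounded (fun x => La (col2 x))) :
  stable_recovery (sampling_mx B D gamma La) <->
  exists2 alpha : R, 0 < alpha &
    leb2.-negligible
      [set x | cnorm (\det (sampling_mx B D gamma La (col2 x))) < alpha].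
Proof.
by apply: stable_recoveryP => i j; exact: sampling_mx_ess_bounded.
Qed.
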